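(* Let $\mathbb{F}$ be a field, let $n,k\in\mathbb{N}$, and let $a_1,\ldots,a_k,r_1,\ldots,r_k\in\mathbb{N}$ with $a_1>a_2>\cdots>a_k$. Let $\lambda:=\left(a_1^{r_1},\ldots,a_k^{r_k}\right)$ be the partition having exactly $r_i$ parts equal to $a_i$ for each $i\in\{1,\ldots,k\}$, and suppose that its length $l(\lambda)=\sum_{i=1}^k r_i$ satisfies $l(\lambda)\leq n$. Let $\mathbf{a}:=(a_1,\ldots,a_k)\in\mathbb{N}^k$. Then, in the ring of symmetric polynomials in $\mathbb{F}[x_1,\ldots,x_n]$, $$l(\lambda)\,m_{\lambda}=\sum_{\mathbf{u}}(-1)^{|\mathbf{u}|-1}\binom{|\mathbf{u}|}{u_1,\ldots,u_k}\,p_{\mathbf{a}\cdot\mathbf{u}}\;m_{\left(a_1^{r_1-u_1},\ldots,a_k^{r_k-u_k}\right)},$$ where the sum is over all nonzero $\mathbf{u}=(u_1,\ldots,u_k)\in\mathbb{Z}_{\geq 0}^k$ with $u_i\leq r_i$ for all $i\in\{1,\ldots,k\}$.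
   Context: $\mathbb{N}$ is the set of positive integers and $\mathbb{Z}_{\geq 0}=\mathbb{N}\cup\{0\}$. A partition is a sequence of nonnegative integers in non-increasing order with only finitely many nonzero terms; its nonzero terms are called its parts, and two partitions with the same parts are considered the same. The length $l(\lambda)$ is the number of parts of $\lambda$. The notation $\left(a_1^{s_1},\ldots,a_k^{s_k}\right)$ denotes the partition with exactly $s_i$ parts equal to $a_i$ for each $i$; if $s_i=0$, there is no part equal to $a_i$ (so if all $s_i=0$ it is the empty partition). Monomial symmetric polynomials: for a partition $\lambda$ with $l(\lambda)\leq n$, write $\lambda=(b_1,\ldots,b_n)$ with $b_1\geq\cdots\geq b_n\geq 0$, adding zeros if necessary. Then $$m_\lambda=\sum_{(c_1,\ldots,c_n)} x_1^{c_1}\cdots x_n^{c_n}\in\mathbb{F}[x_1,\ldots,x_n],$$ where the sum is over all distinct $n$-tuples $(c_1,\ldots,c_n)\in\mathbb{Z}_{\geq 0}^n$ that are permutations of $(b_1,\ldots,b_n)$ (each distinct tuple counted once, including $(b_1,\ldots,b_n)$ itself). In particular $m_\lambda=1$ for the empty partition. If $l(\lambda)>n$ then $m_\lambda:=0$. Power sums: for $j\in\mathbb{N}$, $p_j:=m_{(j)}=\sum_{i=1}^n x_i^j$. For $\mathbf{u}=(u_1,\ldots,u_k)\in\mathbb{Z}^k$, $|\mathbf{u}|=\sum_{i=1}^k u_i$, and $\mathbf{a}\cdot\mathbf{u}=\sum_{i=1}^k a_iu_i$ is the dot product. $\binom{|\mathbf{u}|}{u_1,\ldots,u_k}=\frac{|\mathbf{u}|!}{u_1!\cdots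 u_k!}$ is the multinomial coefficient. Integer coefficients are interpreted in $\mathbb{F}$ via the canonical ring homomorphism $\mathbb{Z}\to\mathbb{F}$. *)

(* Defs.v *)
From mathcomp Require Import all_boot all_order all_algebra.
From mathcomp Require Export mpoly.

Set Implicit Arguments.
Unset Strict Implicit.
Unset Printing Implicit Defensive.

Import GRing.Theory.
Local Open Scope ring_scope.

(* A partition is represented by a non-increasing [seq nat]; zero entries are
   allowed and are not parts. *)
Definition parts (la : seq nat) : seq nat := [seq b <- la | (0 < b)%N].

Definition plength (la : seq nat) : nat := size (parts la).

(* (a_1^{s_1}, ..., a_k^{s_k}); non-increasing when [a] is decreasing, see
   [exp_partition_sorted]. *)
Definition exp_partition (k : nat) (a s : 'I_k -> nat) : seq nat :=
  flatten [seq nseq (s i) (a i) | i <- enum 'I_k].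

Lemma exp_partition_sorted (k : nat) (a s : 'I_k -> nat) :
  (forall i j : 'I_k, (i < j)%N -> (a j < a i)%N) ->
  sorted geq (exp_partition a s).
Proof.
move=> ha; rewrite /exp_partition.
have: sorted (fun i j : 'I_k => (i < j)%N) (enum 'I_k).
  have := iota_ltn_sorted 0 k; rewrite -val_enum_ord.
  by rewrite (sorted_map (e' := ltn)).
rewrite !sorted_pairwise; first last.
- by move=> x y z; apply: ltn_trans.
- by move=> x y z xy yz; apply: leq_trans yz xy.
elim: (enum _) => //= i e IH /andP[/allP hi /IH{}IH].
rewrite pairwise_cat IH andbT; apply/andP; split.
  apply/allrelP => x y; rewrite mem_nseq => /andP[_ /eqP->].
  move=> /flatten_mapP[j je]; rewrite mem_nseq => /andP[_ /eqP->].
  exact/ltnW/ha/hi.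
elim: (s i) => //= m ->; rewrite andbT.
by apply/allP => x; rewrite mem_nseq => /andP[_ /eqP->]; apply: leqnn.
Qed.

(* [permutations] is duplicate-free, so each distinct exponent tuple
   contributes exactly one term. *)
Definition monsym (R : nzRingType) (n : nat) (la : seq nat) : {mpoly R[n]} :=
  if (plength la <= n)%N then
    \sum_(c <- permutations (parts la ++ nseq (n - plength la) 0%N))
      'X_[[multinom nth 0%N c i | i < n]]
  else 0.

Definition powersum (R : nzRingType) (n j : nat) : {mpoly R[n]} :=
  monsym R n [:: j].

(* The natural-number division is exact. *)
Definition multinomial (k : nat) (u : 'I_k -> nat) : nat :=
  ((\sum_i u i)`! %/ \prod_i (u i)`!)%N.

(* Main.v *)
Require Import Defs.
From mathcomp Require Import all_boot all_order all_algebra.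

Set Implicit Arguments.
Unset Strict Implicit.
Unset Printing Implicit Defensive.

Import GRing.Theory.
Local Open Scope ring_scope.

(** The identity is the logarithmic-derivative form of a generating function.
    With one auxiliary variable [y_i] for each distinct part [a_i], put
    [S_j = \sum_i x_j^(a_i) y_i] and [E = \prod_j (1 + S_j)]. Expanding [E]
    amounts to choosing, for each position [j], either no part or one of the
    [a_i]; as the [a_i] are distinct and positive, the coefficient of [y^v] in
    [E] is the monomial symmetric polynomial of [(a_1^(v_1), ..., a_k^(v_k))]
    ([monsym_exp_partition]).

    Apply the Euler operator [\sum_i y_i d/dy_i], which multiplies the
    coefficient of [y^v] by [|v|]. Since [S_j] is homogeneous of degree one,
      [Euler E = \sum_j S_j \prod_(l != j) (1 + S_l)
               = E * \sum_j S_j / (1 + S_j)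
               = E * \sum_j \sum_(d >= 1) (-1)^(d-1) S_j^d].
    By the multinomial theorem ([mcoeff_linform_exp]) the coefficient of [y^u]
    in the last double sum is
      [(-1)^(|u|-1) multinomial(u) \sum_j x_j^(a . u)],
    and the sum over [j] is a power sum ([powersumE]). Comparing the
    coefficients of [y^r] yields the theorem.

    Everything takes place in polynomials in [y] with coefficients in an
    arbitrary commutative ring: instead of dividing by [1 + S_j], the geometric
    series is truncated, and its remainder has too high a degree in [y] to
    contribute to the coefficient of [y^r] ([mcoeff_colour_gf_newton]). *)

(** * Multinomial coefficients *)

Lemma prod_fact_dvd_fact_sum (I : Type) (s : seq I) (u : I -> nat) :
  (\prod_(i <- s) (u i)`! %| (\sum_(i <- s) u i)`!)%N.
Proof.
elim: s => [|i s IHs]; first by rewrite !big_nil.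
rewrite !big_cons; apply: dvdn_trans (dvdn_mul (dvdnn _) IHs) _.
rewrite -(bin_fact (leq_addr (\sum_(j <- s) u j)%N (u i))) addKn.
exact: dvdn_mull.
Qed.

Lemma multinomial_fact (k : nat) (u : 'I_k -> nat) :
  (multinomial u * \prod_i (u i)`! = (\sum_i u i)`!)%N.
Proof. exact/divnK/prod_fact_dvd_fact_sum. Qed.

Lemma eq_multinomial (k : nat) (u v : 'I_k -> nat) :
  u =1 v -> multinomial u = multinomial v.
Proof.
by move=> uv; congr (_`! %/ _)%N; apply: eq_bigr => i _; rewrite uv.
Qed.

Lemma multinomial0 (k : nat) : multinomial (0%MM : 'X_{1..k}) = 1%N.
Proof.
by rewrite /multinomial !big1 // => i _; rewrite mnm0E.
Qed.

(** Both sides, multiplied by the product of the factorials of [u], become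
    [(mdeg u)`!], because [(u i)`! = u i * (u i).-1`!] turns the right-hand
    side into [\sum_i u i * (mdeg u).-1`!]. *)
Lemma multinomial_pascal (k : nat) (u : 'X_{1..k}) : u != 0%MM ->
  multinomial u = (\sum_(i | (0 < u i)%N) multinomial (u - U_(i))%MM)%N.
Proof.
move=> u_neq0.
have deg_gt0 : (0 < mdeg u)%N by rewrite lt0n mdeg_eq0.
apply/eqP; rewrite -(@eqn_pmul2r (\prod_i (u i)`!)%N); last first.
  by rewrite prodn_gt0 // => i; apply: fact_gt0.
rewrite multinomial_fact -mdegE big_distrl /=; apply/eqP.
transitivity (\sum_(i | (0 < u i)%N) u i * (mdeg u).-1`!)%N; last first.
  apply: eq_bigr => i ui_gt0.
  have Ui_le : (U_(i) <= u)%MM by rewrite lep1mP -lt0n.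
  have -> : (\prod_j (u j)`! = u i * \prod_j ((u - U_(i))%MM j)`!)%N.
    rewrite (bigD1 i) //= [in RHS](bigD1 i) //= mnmBE mnm1E eqxx subn1.
    rewrite mulnA -[in (u i)`!](prednK ui_gt0) factS (prednK ui_gt0).
    congr muln; apply: eq_bigr => j ji.
    by rewrite mnmBE mnm1E eq_sym (negbTE ji) subn0.
  rewrite mulnCA multinomial_fact -mdegE; congr (_ * _`!)%N.
  by rewrite -{1}(submK Ui_le) mdegD mdeg1 addn1.
rewrite -big_distrl /= -[in LHS](prednK deg_gt0) factS (prednK deg_gt0).
congr (_ * _)%N; rewrite mdegE [LHS](bigID (fun i => 0 < u i)%N) /=.
by rewrite [X in (_ + X)%N]big1 ?addn0 // => i; rewrite -leqNgt leqn0 => /eqP.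
Qed.

(** * Coefficients of products *)

Section CoefficientOfProducts.
Variables (R : nzRingType) (k : nat).
Implicit Types (p q : {mpoly R[k]}) (u v : 'X_{1..k}).

Lemma mcoeff_mul_var p (i : 'I_k) u :
  (p * 'X_i)@_u = if (0 < u i)%N then p@_(u - U_(i)) else 0.
Proof.
have [ui_gt0|ui_le0] := ltnP.
  have Ui_le : (U_(i) <= u)%MM by rewrite lep1mP -lt0n.
  by rewrite -{1}(submK Ui_le) addmC mcoeffMX.
have /= -> := mcoeff_poly_mul_lin_rev p 'X_i (ltnSn (mdeg u)).
apply: big1 => w /mnm_lepP/(_ i) w_le; rewrite mcoeffX.
case: eqP => [wE|_]; last by rewrite mulr0.
by move: (leq_trans w_le ui_le0); rewrite -wE mnm1E eqxx.
Qed.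

Lemma mcoeff_mul_high_degree p q v (d : nat) :
  (mdeg v < d)%N -> (forall u, (mdeg u < d)%N -> p@_u = 0) -> (p * q)@_v = 0.
Proof.
move=> v_lt p_eq0.
have /= -> := mcoeff_poly_mul_lin p q (ltnSn (mdeg v)).
apply: big1 => u _; rewrite p_eq0 ?mul0r //.
exact: leq_trans (bmdeg u) v_lt.
Qed.

End CoefficientOfProducts.

(** * Powers of a linear form *)

Section LinearForm.
Variables (A : comNzRingType) (k : nat).
Implicit Type z : 'I_k -> A.

Definition linform z : {mpoly A[k]} := \sum_i z i *: 'X_i.

(** The multinomial theorem; the recursion on [d] is Pascal's rule. *)
Lemma mcoeff_linform_exp z (d : nat) (u : 'X_{1..k}) :
  (linform z ^+ d)@_u =
    if mdeg u == d then (multinomial u)%:R * \prod_i z i ^+ u i else 0.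
Proof.
elim: d u => [|d IHd] u.
  rewrite expr0 mcoeff1 mdeg_eq0; case: eqP => // ->.
  rewrite multinomial0 big1 ?mulr1 // => i _.
  by rewrite mnm0E expr0.
rewrite exprSr {2}/linform mulr_sumr raddf_sum /=.
under eq_bigr => i _ do rewrite -scalerAr mcoeffZ mcoeff_mul_var.
case: eqP => [deg_u|deg_u]; last first.
  apply: big1 => i _; case: ifP => ui_gt0; last by rewrite mulr0.
  rewrite IHd; case: eqP => [deg_u'|_]; last by rewrite mulr0.
  case: deg_u; rewrite -deg_u'.
  have Ui_le : (U_(i) <= u)%MM by rewrite lep1mP -lt0n.
  by rewrite -{1}(submK Ui_le) mdegD mdeg1 addn1.
rewrite multinomial_pascal -?mdeg_eq0 ?deg_u // natr_sum mulr_suml.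
rewrite [RHS]big_mkcond /=; apply: eq_bigr => i _.
case: ifP => ui_gt0; last by rewrite mulr0.
have Ui_le : (U_(i) <= u)%MM by rewrite lep1mP -lt0n.
have uE := submK Ui_le.
rewrite IHd ifT; last by rewrite -eqSS -deg_u -{2}uE mdegD mdeg1 addn1.
rewrite mulrCA; congr (_ * _).
rewrite (bigD1 i) //= [in RHS](bigD1 i) //= mulrA -exprS.
congr (_ * _).
  by rewrite mnmBE mnm1E eqxx subn1 prednK.
by apply: eq_bigr => j ji; rewrite mnmBE mnm1E eq_sym (negbTE ji) subn0.
Qed.

(** The partial sum of [S / (1 + S) = S - S^2 + S^3 - ...] at [S = linform z]. *)
Definition log_series z (N : nat) : {mpoly A[k]} :=
  \sum_(d < N) (-1) ^+ d *: linform z ^+ d.+1.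

Lemma linform_eq_log_series z (N : nat) :
  linform z = (1 + linform z) * log_series z N
              + (-1) ^+ N *: linform z ^+ N.+1.
Proof.
elim: N => [|N IHN].
  by rewrite /log_series big_ord0 mulr0 add0r expr0 scale1r.
rewrite /log_series big_ord_recr /= mulrDr -addrA {1}IHN; congr (_ + _).
rewrite -scalerAr mulrDl mul1r -exprS scalerDr [in X in _ + X]exprS mulN1r.
by rewrite scaleNr addrK.
Qed.

Lemma mcoeff_log_series z (N : nat) (u : 'X_{1..k}) : (mdeg u <= N)%N ->
  (log_series z N)@_u =
    if u == 0%MM then 0
    else (-1) ^+ (mdeg u).-1 * (multinomial u)%:R * \prod_i z i ^+ u i.
Proof.
move=> deg_u; rewrite /log_series raddf_sum /=.
under eq_bigr => d _ do rewrite mcoeffZ mcoeff_linform_exp.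
rewrite -mdeg_eq0; case: (mdeg u) deg_u => [|e] e_lt.
  by apply: big1 => d _; rewrite mulr0.
rewrite (bigD1 (Ordinal e_lt)) //= eqxx mulrA [X in _ + X]big1 ?addr0 // => d.
rewrite -val_eqE /= => d_neq.
by rewrite eqSS eq_sym ifN ?mulr0.
Qed.

End LinearForm.

(** * The generating function of partial colourings *)

Lemma big_option (T : Type) (idx : T) (op : Monoid.com_law idx) (I : finType)
    (G : option I -> T) :
  \big[op/idx]_c G c = op (G None) (\big[op/idx]_i G (Some i)).
Proof.
rewrite (bigD1 None) //=; congr (op _ _).
rewrite (reindex_omap Some id); last by case.
by apply: eq_bigl => i; rewrite eqxx.
Qed.

Section ColourGeneratingFunction.
Variables (A : comNzRingType) (k n : nat).
Implicit Type x : 'I_n -> 'I_k -> A.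

(** The monomials of the expansion of this product are the partial colourings
    of the [n] positions by [k] colours; position [j] gets colour [i] with
    weight [x j i]. *)
Definition colour_gf x : {mpoly A[k]} := \prod_j (1 + linform (x j)).

Definition colour_term x (j : 'I_n) (c : option 'I_k) : {mpoly A[k]} :=
  oapp (fun i => x j i *: 'X_i) 1 c.

Lemma sum_colour_term x j : \sum_c colour_term x j c = 1 + linform (x j).
Proof. by rewrite big_option. Qed.

Definition colour_count (f : {ffun 'I_n -> option 'I_k}) : 'X_{1..k} :=
  [multinom \sum_j (f j == Some i) | i < k].

Lemma mdeg_colour_count f : mdeg (colour_count f) = (\sum_j (f j : bool))%N.
Proof.
rewrite mdegE; under eq_bigr => i _ do rewrite mnmE.
rewrite exchange_big /=; apply: eq_bigr => j _.
case: (f j) => [i|] /=; last by rewrite big1.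
rewrite (bigD1 i) //= eqxx big1 // => i' i'i.
by rewrite (inj_eq Some_inj) eq_sym (negbTE i'i).
Qed.

Lemma prod_colour_term x (f : {ffun 'I_n -> option 'I_k}) :
  \prod_j colour_term x j (f j) =
    (\prod_j oapp (x j) 1 (f j)) *: 'X_[colour_count f].
Proof.
rewrite (eq_bigr (fun j => oapp (x j) 1 (f j) *:
            'X_[oapp (fun i => U_(i)%MM) 0%MM (f j)])); last first.
  by move=> j _; case: (f j) => //=; rewrite mpolyX0 scale1r.
rewrite scaler_prod mprodXE; congr (_ *: 'X_[_]).
apply/mnmP => i; rewrite mnm_sumE mnmE; apply: eq_bigr => j _.
by case: (f j) => [i'|] /=; rewrite ?mnm1E ?mnm0E.
Qed.

Lemma mcoeff_colour_gf x (v : 'X_{1..k}) :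
  (colour_gf x)@_v =
    \sum_(f | colour_count f == v) \prod_j oapp (x j) 1 (f j).
Proof.
rewrite /colour_gf (eq_bigr _ (fun j _ => esym (sum_colour_term x j))).
rewrite bigA_distr_bigA raddf_sum /= [RHS]big_mkcond /=.
apply: eq_bigr => f _; rewrite prod_colour_term mcoeffZ mcoeffX.
by case: eqP; rewrite ?mulr1 ?mulr0.
Qed.

(** Euler's identity for [colour_gf], by double counting: [mdeg v] is the number
    of coloured positions, and the summand [j] of the right-hand side collects
    the colourings in which position [j] is coloured. *)
Lemma mcoeff_colour_gf_euler x (v : 'X_{1..k}) :
  (mdeg v)%:R * (colour_gf x)@_v =
    \sum_j (linform (x j) * \prod_(l | l != j) (1 + linform (x l)))@_v.
Proof.
(* [w j] kills exactly the colourings that leave position [j] uncoloured. *)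
pose w j l (c : option 'I_k) : {mpoly A[k]} :=
  if (l == j) && (c == None) then 0 else colour_term x l c.
transitivity (\sum_j (\prod_l \sum_c w j l c)@_v); last first.
  apply: eq_bigr => j _; congr (_@_v); rewrite (bigD1 j) //=; congr (_ * _).
    by rewrite big_option /w eqxx /= add0r.
  apply: eq_bigr => l lj; rewrite -sum_colour_term; apply: eq_bigr => c _.
  by rewrite /w (negbTE lj).
under [in RHS]eq_bigr => j _ do rewrite bigA_distr_bigA raddf_sum /=.
rewrite exchange_big /= mcoeff_colour_gf big_mkcond mulr_sumr /=.
apply: eq_bigr => f _.
transitivity
  (\sum_j (f j : bool)%:R * (\prod_l colour_term x l (f l))@_v); last first.
  apply: eq_bigr => j _; case fj: (f j) => [i|] /=.
    rewrite mul1r; congr (_@_v); apply: eq_bigr => l _.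
    by rewrite /w; case: eqP => // ->; rewrite fj.
  by rewrite mul0r (bigD1 j) //= {1}/w eqxx fj /= mul0r mcoeff0.
rewrite -mulr_suml prod_colour_term mcoeffZ mcoeffX.
case: eqP => [<-|_]; last by rewrite !mulr0.
by rewrite mulr1 mdeg_colour_count natr_sum.
Qed.

(** Substituting the truncated series of [S / (1 + S)] for [S] in Euler's
    identity restores the missing factor [1 + S] of the product. *)
Lemma mcoeff_colour_gf_newton x (v : 'X_{1..k}) :
  (mdeg v)%:R * (colour_gf x)@_v =
    \sum_(u : 'X_{1..k < (mdeg v).+1} | (u <= v)%MM && (bmnm u != 0%MM))
      (-1) ^+ (mdeg u).-1 * (multinomial u)%:R
        * (\sum_j \prod_i x j i ^+ u i) * (colour_gf x)@_(v - u).
Proof.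
rewrite mcoeff_colour_gf_euler.
transitivity (\sum_j \sum_(u : 'X_{1..k < (mdeg v).+1} | (u <= v)%MM)
    (log_series (x j) (mdeg v))@_u * (colour_gf x)@_(v - u)).
  apply: eq_bigr => j _; set N := mdeg v.
  have /= <- := mcoeff_poly_mul_lin (log_series (x j) N) (colour_gf x) (ltnSn N).
  rewrite {1}(linform_eq_log_series (x j) N) mulrDl mcoeffD mulrAC.
  rewrite -(bigD1 j (P := xpredT) (F := fun l => 1 + linform (x l))) //=.
  rewrite -/(colour_gf x) -scalerAl mcoeffZ.
  rewrite (@mcoeff_mul_high_degree _ _ (_ ^+ _) _ _ N.+1) //.
    by rewrite mulr0 addr0 mulrC.
  by move=> u u_lt; rewrite mcoeff_linform_exp ifN // neq_ltn u_lt.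
rewrite exchange_big /= [RHS]big_mkcondr /=; apply: eq_bigr => u _.
have deg_u : (mdeg u <= mdeg v)%N by rewrite -ltnS bmdeg.
under eq_bigr => j _ do rewrite mcoeff_log_series //.
case: eqP => [_|_] /=; first by apply: big1 => j _; rewrite mul0r.
by rewrite -mulr_suml -mulr_sumr.
Qed.

End ColourGeneratingFunction.

Lemma size_sum_count_mem (C : finType) (s : seq C) :
  size s = (\sum_c count_mem c s)%N.
Proof.
elim: s => [|x s IHs] /=; first by rewrite big1.
rewrite big_split /= -IHs (bigD1 x) //= eqxx big1 // => c /negbTE.
by rewrite eq_sym => ->.
Qed.

(** * Monomial symmetric polynomials as coefficients *)

Section Arrangements.
Variables (n : nat) (C : finType).
Implicit Types (A : C -> nat) (f : {ffun 'I_n -> C}) (s : seq C).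

Lemma nth_map_codom A f (j : 'I_n) : nth 0%N (map A (codom f)) j = A (f j).
Proof.
by rewrite codomE -map_comp (nth_map j) ?size_enum_ord // nth_ord_enum.
Qed.

Lemma codom_nth (x0 : C) s : size s = n ->
  codom [ffun j : 'I_n => nth x0 s j] = s.
Proof.
move=> size_s; apply: (@eq_from_nth _ x0); rewrite size_codom card_ord ?size_s //.
move=> j j_lt; rewrite codomE (nth_map (Ordinal j_lt)) ?size_enum_ord //.
by rewrite ffunE nth_enum_ord.
Qed.

(** Injectivity of [A] is what makes each distinct exponent tuple arise from a
    single colouring. *)
Lemma perm_permutations_map (x0 : C) A s : injective A -> size s = n ->
  perm_eq (permutations (map A s))
    [seq map A (codom f) | f : {ffun 'I_n -> C} <- index_enum _
                          & perm_eq (codom f) s].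
Proof.
move=> A_inj size_s; apply: uniq_perm; first exact: permutations_uniq.
  rewrite map_inj_in_uniq ?filter_uniq ?index_enum_uniq // => f g _ _ fg.
  by apply/ffunP => j; apply: A_inj; rewrite -!nth_map_codom fg.
move=> c; rewrite mem_permutations; apply/idP/mapP => [|[f]]; last first.
  by rewrite mem_filter => /andP[f_perm _] ->; apply: perm_map.
case/(perm_iotaP 0%N); rewrite size_map => Is Is_perm ->.
pose t := [seq nth x0 s i | i <- Is].
have t_perm : perm_eq t s by apply/(perm_iotaP x0); exists Is.
have size_t : size t = n by rewrite (perm_size t_perm).
exists [ffun j : 'I_n => nth x0 t j].
  by rewrite mem_filter codom_nth // t_perm mem_index_enum.
rewrite codom_nth // -map_comp; apply/eq_in_map => i.
by rewrite (perm_mem Is_perm) mem_iota /= add0n => i_lt; rewrite (nth_map x0).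
Qed.

Lemma sum_permutations_map (R : comNzRingType) (x0 : C) A s :
  injective A -> size s = n ->
  \sum_(c <- permutations (map A s))
      'X_[[multinom nth 0%N c i | i < n]] =
  \sum_(f : {ffun 'I_n -> C} | perm_eq (codom f) s)
      \prod_j ('X_j : {mpoly R[n]}) ^+ A (f j).
Proof.
move=> A_inj size_s.
rewrite (perm_big _ (perm_permutations_map x0 A_inj size_s)).
rewrite big_map big_filter; apply: eq_bigr => f _.
by rewrite mpolyXE_id; apply: eq_bigr => j _; rewrite mnmE nth_map_codom.
Qed.

End Arrangements.

Section MonomialSymmetric.
Variables (R : comNzRingType) (n k : nat).
Implicit Types (a : 'I_k -> nat) (v : 'X_{1..k}).

Lemma parts_exp_partition a (v : 'I_k -> nat) : (forall i, 0 < a i)%N ->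
  parts (exp_partition a v) = exp_partition a v.
Proof.
move=> a_gt0; apply/all_filterP/allP => x /flatten_mapP[i _].
by rewrite mem_nseq => /andP[_ /eqP->].
Qed.

Lemma size_exp_partition a (v : 'I_k -> nat) :
  size (exp_partition a v) = (\sum_i v i)%N.
Proof.
rewrite /exp_partition size_flatten /shape -map_comp sumnE big_map big_enum /=.
by apply: eq_bigr => i _; rewrite size_nseq.
Qed.

Lemma plength_exp_partition a (v : 'I_k -> nat) : (forall i, 0 < a i)%N ->
  plength (exp_partition a v) = (\sum_i v i)%N.
Proof.
by move=> a_gt0; rewrite /plength parts_exp_partition ?size_exp_partition.
Qed.

(** A colouring with colour count [v], written as a word of length [n]; its
    image under the exponents is the zero-padded partition whose distinct
    rearrangements [monsym] sums over. *)
Definition colour_word v : seq (option 'I_k) :=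
  flatten [seq nseq (v i) (Some i) | i <- enum 'I_k] ++ nseq (n - mdeg v) None.

Lemma size_colour_word v : (mdeg v <= n)%N -> size (colour_word v) = n.
Proof.
move=> v_le; rewrite size_cat size_nseq size_flatten /shape -map_comp sumnE.
rewrite big_map big_enum /= (eq_bigr v) => [|i _]; last by rewrite /= size_nseq.
by rewrite -mdegE subnKC.
Qed.

Lemma count_colour_word v i : count_mem (Some i) (colour_word v) = v i.
Proof.
rewrite count_cat count_nseq /= mul0n addn0 count_flatten -map_comp sumnE.
rewrite big_map big_enum /= (bigD1 i) //= count_nseq /= eqxx mul1n big1 ?addn0 //.
by move=> j ji; rewrite count_nseq /= (inj_eq Some_inj) (negbTE ji).
Qed.

Lemma colour_count_codom (f : {ffun 'I_n -> option 'I_k}) i :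
  colour_count f i = count_mem (Some i) (codom f).
Proof.
rewrite mnmE codomE count_map -sum1_count [RHS]big_mkcond big_enum /=.
by apply: eq_bigr => j _; case: eqP.
Qed.

Lemma perm_colour_word (f : {ffun 'I_n -> option 'I_k}) v : (mdeg v <= n)%N ->
  perm_eq (codom f) (colour_word v) = (colour_count f == v).
Proof.
move=> v_le; apply/idP/eqP => [/permP f_perm|fv].
  by apply/mnmP => i; rewrite colour_count_codom f_perm count_colour_word.
have count_Some i :
    count_mem (Some i) (codom f) = count_mem (Some i) (colour_word v).
  by rewrite count_colour_word -fv colour_count_codom.
(* The number of uncoloured positions is what remains of the length [n]. *)
have : size (codom f) = size (colour_word v).
  by rewrite size_codom card_ord size_colour_word.
rewrite !size_sum_count_mem !big_option /= (eq_bigr _ (fun i _ => count_Some i)).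
move/addIn => count_None; apply/allP => -[i|] _ /=; first by rewrite count_Some.
by rewrite count_None.
Qed.

(** The uncoloured positions are those with exponent [0]; this is why the [a i]
    have to be positive as well as distinct. *)
Lemma monsym_exp_partition a v :
  (forall i, 0 < a i)%N -> injective a -> (mdeg v <= n)%N ->
  monsym R n (exp_partition a v) = (colour_gf (fun j i => 'X_j ^+ a i))@_v.
Proof.
move=> a_gt0 a_inj v_le.
rewrite /monsym plength_exp_partition // -mdegE v_le parts_exp_partition //.
pose A := oapp a 0%N.
have A_inj : injective A.
  move=> [i|] [j|] //=; first by move/a_inj ->.
    by move=> ai0; have := a_gt0 i; rewrite ai0.
  by move=> aj0; have := a_gt0 j; rewrite -aj0.
have -> : exp_partition a v ++ nseq (n - mdeg v) 0%N = map A (colour_word v).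
  rewrite map_cat map_flatten map_nseq -map_comp; congr (flatten _ ++ _).
  by apply: eq_map => i /=; rewrite map_nseq.
rewrite (sum_permutations_map R None A_inj (size_colour_word v_le)).
rewrite mcoeff_colour_gf; apply: eq_big => f; first exact: perm_colour_word.
by move=> _; apply: eq_bigr => j _; case: (f j).
Qed.

End MonomialSymmetric.

(** * The power sum identity *)

Lemma mcoeff0_prod_one_linform (A : comNzRingType) (k : nat) (I : Type)
    (s : seq I) (P : pred I) (x : I -> 'I_k -> A) :
  (\prod_(l <- s | P l) (1 + linform (x l)))@_0%MM = 1.
Proof.
rewrite rmorph_prod big1 // => l _ /=.
rewrite mcoeffD mcoeff1 eqxx -[linform _]expr1 mcoeff_linform_exp.
by rewrite mdeg0 addr0.
Qed.

(** With a single colour and [v = 1], Euler's identity reads off the linear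
    coefficient of [\prod_l (1 + x_l^j y)]. *)
Lemma powersumE (R : comNzRingType) (n j : nat) : (0 < n)%N -> (0 < j)%N ->
  powersum R n j = \sum_(l < n) 'X_l ^+ j.
Proof.
move=> n_gt0 j_gt0; rewrite /powersum.
pose a (i : 'I_1) := j; pose v : 'X_{1..1} := U_(ord0)%MM.
have -> : [:: j] = exp_partition a v.
  by rewrite /exp_partition enum_ordSl enum_ord0 /= mnm1E.
rewrite monsym_exp_partition ?mdeg1 //; last by move=> i i'; rewrite !ord1.
rewrite -[LHS]mul1r -[1]/(1%:R) -{1}(mdeg1 (ord0 : 'I_1)) mcoeff_colour_gf_euler.
apply: eq_bigr => l _.
rewrite /linform big_ord1 mulrC -scalerAr mcoeffZ mcoeff_mul_var mnm1E eqxx /=.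
by rewrite -{1}(add0m U_(ord0)%MM) addmK mcoeff0_prod_one_linform mulr1.
Qed.

Theorem theorem3p0p1 (F : fieldType) (n k : nat) (a r : 'I_k -> nat)
  (n_gt0 : (0 < n)%N) (k_gt0 : (0 < k)%N)
  (a_gt0 : forall i : 'I_k, (0 < a i)%N)
  (r_gt0 : forall i : 'I_k, (0 < r i)%N)
  (a_decr : forall i j : 'I_k, (i < j)%N -> (a j < a i)%N)
  (len_le : (plength (exp_partition a r) <= n)%N) :
  (plength (exp_partition a r))%:R *: monsym F n (exp_partition a r) =
  \sum_(u : {dffun forall i : 'I_k, 'I_(r i).+1} | [exists i, u i != ord0])
     ((-1) ^+ (\sum_i (u i : nat))%N.-1 * (multinomial (fun i : 'I_k => u i))%:R) *:
     (powersum F n (\sum_i a i * u i)%N *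
      monsym F n (exp_partition a (fun i : 'I_k => (r i - u i)%N))).
Proof.
have a_inj : injective a.
  move=> i j aij; apply: val_inj => /=.
  by case: (ltngtP i j) => // /a_decr; rewrite aij ltnn.
pose v : 'X_{1..k} := [multinom r i | i < k].
have eq_exp (s t : 'I_k -> nat) :
    s =1 t -> exp_partition a s = exp_partition a t.
  by move=> st; congr flatten; apply: eq_map => i; rewrite st.
have vE i : v i = r i by rewrite mnmE.
have deg_v : plength (exp_partition a r) = mdeg v.
  by rewrite plength_exp_partition // mdegE; apply: eq_bigr => i _; rewrite vE.
rewrite deg_v in len_le *; rewrite (eq_exp _ _ (fsym vE)).
rewrite monsym_exp_partition // scaler_nat -mulr_natl mcoeff_colour_gf_newton.
pose mnm_of (u : {dffun forall i : 'I_k, 'I_(r i).+1}) : 'X_{1..k} :=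
  [multinom (u i : nat) | i < k].
have mnmE_u u i : mnm_of u i = u i by rewrite mnmE.
have mnm_of_le u : (mnm_of u <= v)%MM.
  by apply/mnm_lepP => i; rewrite vE mnmE -ltnS.
have mnm_of_lt u : (mdeg (mnm_of u) < (mdeg v).+1)%N.
  by rewrite ltnS -(submK (mnm_of_le u)) mdegD leq_addl.
pose dffun_of (w : 'X_{1..k < (mdeg v).+1}) :=
  [ffun i => inord (w i)] : {dffun forall i : 'I_k, 'I_(r i).+1}.
(* The multi-indices below [v] are the tuples [u] with [u i <= r i]. *)
rewrite (reindex_onto (fun u => BMultinom (mnm_of_lt u)) dffun_of) /=; last first.
  move=> w /andP[/mnm_lepP w_le _]; apply/val_inj/mnmP => i /=.
  by rewrite mnmE ffunE inordK // ltnS -vE.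
apply: eq_big => [u|u /andP[/andP[_ u_neq0] _]].
  rewrite mnm_of_le /=; have -> : dffun_of (BMultinom (mnm_of_lt u)) == u.
    by apply/eqP/ffunP => i; rewrite ffunE /= mnmE inord_val.
  rewrite andbT -negb_forall; congr (~~ _); apply/eqP/forallP => [u0 i|u0].
    by rewrite -val_eqE /= -mnmE_u u0 mnm0E.
  by apply/mnmP => i; rewrite mnmE mnm0E (eqP (u0 i)).
have -> : exp_partition a (fun i => (r i - u i)%N)
          = exp_partition a (v - mnm_of u)%MM.
  by apply: eq_exp => i; rewrite mnmBE vE mnmE_u.
rewrite monsym_exp_partition //; last exact: leq_trans (mdegB _ _) len_le.
rewrite powersumE //; last first.
  rewrite lt0n sum_nat_eq0; apply: contraNN u_neq0 => /forallP u0.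
  apply/eqP/mnmP => i; move: (u0 i).
  by rewrite mnmE_u mnm0E muln_eq0 eqn0Ngt a_gt0 => /eqP.
rewrite -mul_mpolyC rmorphM rmorphXn rmorphN1 rmorph_nat mulrA; congr (_ * _).
rewrite mdegE (eq_bigr _ (fun i _ => mnmE_u u i)) (eq_multinomial (mnmE_u u)).
congr (_ * _).
apply: eq_bigr => j _; rewrite -prodrXr; apply: eq_bigr => i _.
by rewrite exprM mnmE_u.
Qed.
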